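(* There exist constants $c_1,c_2>0$ and $N$ such that for every $n\ge N$ and every integer $k$ with $c_1<k<\frac{1}{3}n-c_2$, the pair $(n,k)$ is not good; that is, there is an $n$-vertex graph all of whose minimum $k$-spanners have girth at most $k+1$.
   Context: All graphs are undirected and unweighted. For a graph $G=(V,E)$ and integer $k$, a $k$-spanner of $G$ is a subgraph $H=(V,E')$, $E'\subseteq E$, with $\mathrm{dist}_H(u,v)\le k\cdot\mathrm{dist}_G(u,v)$ for all $u,v\in V$. A minimum $k$-spanner is a $k$-spanner with the fewest edges. Girth = length of a shortest cycle ($+\infty$ if acyclic). A pair $(n,k)$ is good if for every $n$-vertex graph at least one of its minimum $k$-spanners has girth at least $k+2$. *)

(* Defs.v *)
From mathcomp Require Import all_boot all_order all_algebra.
Set Implicit Arguments. Unset Strict Implicit. Unset Printing Implicit Defensive.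

Section Graphs.
Variable n : nat.
Local Notation V := 'I_n.

Definition simple_graph (G : rel V) : Prop := symmetric G /\ irreflexive G.

Definition nedges (G : rel V) : nat :=
  #|[set p : V * V | (p.1 < p.2)%N && G p.1 p.2]|.

Fixpoint walkb (G : rel V) (d : nat) (u v : V) : bool :=
  if d is d'.+1 then [exists w, G u w && walkb G d' w v] else u == v.

(* graph distance: Some d = length of a shortest u-v walk, None = infinity.
   (A shortest walk, if any, has fewer than n edges.) *)
Definition dist (G : rel V) (u v : V) : option nat :=
  ohead [seq d <- iota 0 n | walkb G d u v].

Definition subgraph (H G : rel V) : Prop := simple_graph H /\ subrel H G.

Definition spanner (k : nat) (G H : rel V) : Prop :=
  subgraph H G /\
  forall u v, match dist G u v with
              | Some d => exists d', dist H u v = Some d' /\ (d' <= k * d)%N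
              | None => True
              end.

Definition min_spanner (k : nat) (G H : rel V) : Prop :=
  spanner k G H /\ forall H', spanner k G H' -> (nedges H <= nedges H')%N.

Definition has_cycle_of_length (G : rel V) (l : nat) : bool :=
  [exists t : l.-tuple V, uniq t && cycle G t].

Definition girth (G : rel V) : option nat :=
  ohead [seq l <- iota 3 n | has_cycle_of_length G l].

Definition girth_at_least (G : rel V) (g : nat) : Prop :=
  match girth G with Some g' => (g <= g')%N | None => True end.

End Graphs.

Definition good (n k : nat) : Prop :=
  forall G : rel 'I_n, simple_graph G ->
    exists H : rel 'I_n, min_spanner k G H /\ girth_at_least H (k + 2).

(* Main.v *)
(** A core path 0, ..., w and an ear 0 (a path with interior vertices of degree
    two) joining its ends form a cycle C of length k+1.  Three long ears span
    arcs of C that are shorter than (k+1)/2 and cover C; each closes a cycle of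
    length k+1 with its arc.  The arcs of ears 2 and 3 overlap in ear 0, and a
    triangle is erected on every other edge of C.  Deleting one edge of each
    long ear and one side of each triangle leaves a k-spanner containing C.  In
    a k-spanner of girth at least k+2 some edge e of C is missing.  Each
    triangle and each ear misses at most one edge, and a long ear misses none
    when an edge of its arc is missing, since only that arc would be a detour
    short enough.  So ears 0 and 2 together miss at most one edge, and the long
    ear whose arc contains e (ear 3 if ear 0 is broken) misses none: such a
    spanner misses fewer edges than the first one.  The graph has 3k + O(1)
    vertices; the others are isolated. *)
Require Import Defs.
From mathcomp Require Import all_boot all_order all_algebra.
From mathcomp Require Import zify lra.
Import GRing.Theory Num.Theory.
Set Implicit Arguments. Unset Strict Implicit. Unset Printing Implicit Defensive.

(** * First hits when searching an interval of naturals *)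

Lemma ohead_filter_iota (P : pred nat) (a n x : nat) :
  a <= x < a + n -> P x ->
  exists2 y, ohead [seq z <- iota a n | P z] = Some y & y <= x.
Proof.
elim: n a => [|n IHn] a ax Px /=; first by lia.
case Pa: (P a); first by exists a => //; lia.
apply: IHn => //; suff: a != x by lia.
by apply: contraFneq Pa => ->.
Qed.

Lemma ohead_filter (P : pred nat) (s : seq nat) (x : nat) :
  ohead (filter P s) = Some x -> P x.
Proof. by elim: s => //= y s IHs; case: ifP => // Py [<-]. Qed.

(** * Walks, spanners and missing edges *)

Section Walks.
Variable n : nat.
Implicit Types (G H : rel 'I_n) (u v : 'I_n).

Lemma walkb1 H u v : walkb H 1 u v = H u v.
Proof.
apply/existsP/idP => [[x /andP[Hux /eqP <-]] //|Huv].
by exists v; rewrite Huv /=.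
Qed.

Lemma walkb_path H d u v :
  walkb H d u v -> exists p, [/\ path H u p, last u p = v & size p = d].
Proof.
elim: d u => [|d IHd] u /=; first by move/eqP=> <-; exists [::].
case/existsP=> x /andP[Hux /IHd[p [pathp lastp sizep]]].
by exists (x :: p); rewrite /= Hux pathp lastp sizep.
Qed.

Lemma path_walkb H u p : path H u p -> walkb H (size p) u (last u p).
Proof.
elim: p u => [|x p IHp] u //= /andP[Hux /IHp Hp].
by apply/existsP; exists x; rewrite Hux.
Qed.

Lemma walkb_cat H d1 d2 u v x :
  walkb H d1 u v -> walkb H d2 v x -> walkb H (d1 + d2) u x.
Proof.
move=> /walkb_path[p [Hp <- <-]] /walkb_path[q [Hq <- <-]].
by rewrite -size_cat -last_cat path_walkb // cat_path Hp.
Qed.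

Lemma walkb_rev H d u v : symmetric H -> walkb H d u v -> walkb H d v u.
Proof.
move=> symH; elim: d u => [|d IHd] u /=; first by rewrite eq_sym.
case/existsP=> x /andP[Hux /IHd Hvx].
have Hxu : walkb H 1 x u by rewrite walkb1 symH.
by have := walkb_cat Hvx Hxu; rewrite addn1.
Qed.

(** Removing repeated vertices leaves fewer than [n] edges, so the search range in [dist] is wide
    enough. *)
Lemma walkb_short H d u v :
  walkb H d u v -> exists d', [/\ walkb H d' u v, d' <= d & d' < n].
Proof.
case/walkb_path=> p [Hp <- <-]; case/shortenP: Hp => q Hq uq sub_qp.
exists (size q); split; first exact: path_walkb.
  by apply: uniq_leq_size => //; case/andP: uq.
by move/card_uniqP: uq (max_card (mem (u :: q))) => /= ->; rewrite card_ord.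
Qed.

Lemma walkb_dist H d u v :
  walkb H d u v -> exists2 d', dist H u v = Some d' & d' <= d.
Proof.
case/walkb_short=> e [He le_ed lt_en].
rewrite /dist; have [//|d' -> le_d'e] := @ohead_filter_iota (fun i => walkb H i u v) 0 n e _ He.
by exists d' => //; apply: leq_trans le_ed.
Qed.

Lemma dist_walkb H d u v : dist H u v = Some d -> walkb H d u v.
Proof. by move/ohead_filter. Qed.

(** Potentials bound walk lengths from below; all short detours are excluded this way. *)
Lemma walkb_lipschitz H (phi : 'I_n -> nat) d u v :
  (forall x y, H x y -> phi y <= phi x + 1) ->
  walkb H d u v -> phi v <= phi u + d.
Proof.
move=> lip; elim: d u => [|d IHd] u /=; first by move/eqP=> ->; rewrite addn0.
case/existsP=> x /andP[/lip le_xu /IHd le_vx]; lia.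
Qed.

(** Only edges need checking: replace each edge of a shortest walk by its detour. *)
Lemma spannerI k G H :
  subgraph H G ->
  (forall u v, G u v -> exists2 d, d <= k & walkb H d u v) ->
  spanner k G H.
Proof.
move=> subHG edgeH; split=> // u v.
case distG: (dist G u v) => [d|//].
have: exists2 e, e <= k * d & walkb H e u v.
  move/dist_walkb: distG; elim: d u => [|d IHd] u /=.
    by move/eqP=> ->; exists 0; rewrite /= ?eqxx.
  case/existsP=> x /andP[/edgeH[d1 le_d1 H1] /IHd[d2 le_d2 H2]].
  by exists (d1 + d2); [lia | apply: walkb_cat H2].
case=> e le_e /walkb_dist[d' distH le_d'].
by exists d'; split=> //; apply: leq_trans le_e.
Qed.

Lemma spanner_edge k G H u v :
  spanner k G H -> G u v -> exists2 d, d <= k & walkb H d u v.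
Proof.
case=> _ /(_ u v) distGH; rewrite -walkb1 => /walkb_dist[d distG le_d1].
rewrite distG in distGH; case: distGH => d' [/dist_walkb Hd' le_d'].
by exists d' => //; nia.
Qed.

Definition missing G H : {set 'I_n * 'I_n} :=
  [set p : 'I_n * 'I_n | [&& p.1 < p.2, G p.1 p.2 & ~~ H p.1 p.2]].

Lemma nedges_missing G H :
  subrel H G -> nedges H + #|missing G H| = nedges G.
Proof.
move=> subHG; rewrite [in RHS]/nedges.
rewrite -(cardsID [set p : 'I_n * 'I_n | H p.1 p.2]
  [set p : 'I_n * 'I_n | (p.1 < p.2) && G p.1 p.2]).
congr (_ + _); apply: eq_card => p; rewrite !inE.
  case Hp: (H p.1 p.2); rewrite ?andbT ?andbF //.
  by rewrite (subHG _ _ Hp) andbT.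
by case: (p.1 < p.2); case: (G _ _); case: (H _ _).
Qed.

Lemma girth_short_cycle H l :
  2 < l <= n -> has_cycle_of_length H l -> ~ girth_at_least H l.+1.
Proof.
move=> lt_l cycH.
have [|y] := @ohead_filter_iota (has_cycle_of_length H) 3 n l _ cycH; first lia.
by rewrite /girth_at_least /girth => ->; lia.
Qed.

End Walks.

(** * Graphs obtained by attaching ears to a core *)

Section EarGraph.

Variables (n' w m k : nat) (xs ys bs : nat -> nat).
Local Notation n := n'.+1.
Let sh := mkseq (fun c => (bs c).-1) m.

Hypothesis xs_le : forall c, c < m -> xs c <= w.
Hypothesis ys_le : forall c, c < m -> ys c <= w.
Hypothesis xs_ys : forall c, c < m -> xs c != ys c.
Hypothesis bs_gt0 : forall c, c < m -> 0 < bs c.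
Hypothesis size_le : w.+1 + sumn sh <= n.

(** Core vertices are 0 to [w]; interior vertices are numbered after them, ear by ear, with [sh]
    listing how many each ear has. *)
Definition vtx (c p : nat) : nat :=
  if p == 0 then xs c else if p == bs c then ys c
  else w.+1 + flatten_index sh c p.-1.

Definition ear_vertex (c p : nat) : 'I_n := inord (vtx c p).
Local Notation V := ear_vertex.

Lemma vtx_interior c p : c < m -> 0 < p < bs c -> w < vtx c p < n.
Proof.
move=> lt_cm lt_p; rewrite /vtx.
have [-> ->] : (p == 0) = false /\ (p == bs c) = false by split; lia.
suff: flatten_index sh c p.-1 < sumn sh by move: size_le; lia.
apply: flatten_indexP; rewrite nth_mkseq //; lia.
Qed.

Lemma val_ear_vertex c p : c < m -> p <= bs c -> V c p = vtx c p :> nat.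
Proof.
move=> lt_cm le_p; rewrite inordK //.
case p0: (0 < p < bs c); first by have /andP[] := vtx_interior lt_cm p0.
move: size_le (xs_le lt_cm) (ys_le lt_cm); rewrite /vtx.
by have [_|pn0] := eqVneq p 0; [|have [_|pnb] := eqVneq p (bs c)]; lia.
Qed.

(** Ears meet only in the core, so values along ears that agree with [f] there glue to one function;
    an interior vertex is decoded by inverting the flat numbering. *)
Lemma ear_function (f : nat -> nat) (e : nat -> nat -> nat) :
  (forall c, c < m -> e c 0 = f (xs c)) ->
  (forall c, c < m -> e c (bs c) = f (ys c)) ->
  exists phi : 'I_n -> nat,
    forall c p, c < m -> p <= bs c -> phi (V c p) = e c p.
Proof.
move=> e0 eb; exists (fun v : 'I_n => if v <= w then f v else
  e (reshape_index sh (v - w.+1)) (reshape_offset sh (v - w.+1)).+1).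
move=> c p lt_cm le_p; rewrite !val_ear_vertex //.
case p0: (0 < p < bs c); last first.
  move: (xs_le lt_cm) (ys_le lt_cm) => lex ley; rewrite /vtx.
  have [->|pn0] := eqVneq p 0; first by rewrite lex e0.
  have [->|pnb] := eqVneq p (bs c); first by rewrite ley eb.
  lia.
have /andP[] := vtx_interior lt_cm p0; rewrite ltnNge => /negbTE -> _.
have -> : vtx c p - w.+1 = flatten_index sh c p.-1.
  rewrite /vtx; case: ifP => [|_]; first lia.
  by case: ifP => [|_]; [lia | rewrite addKn].
rewrite flatten_indexKl ?flatten_indexKr ?nth_mkseq //; try lia.
by congr e; lia.
Qed.

Lemma ear_vertex_inj c p c' p' :
  c < m -> c' < m -> 0 < p < bs c -> p' <= bs c' ->
  V c p = V c' p' -> c = c' /\ p = p'.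
Proof.
move=> lt_c lt_c' p0 le_p' eqV.
(* Two functions vanishing on the core recover the ear (shifted by one) and the position. *)
pose e1 c p := if 0 < p < bs c then c.+1 else 0.
pose e2 c p := if 0 < p < bs c then p else 0.
have [|i _|phi1 phi1E] := @ear_function (fun=> 0) e1; first by move=> i _.
  by rewrite /e1 ltnn andbF.
have [|i _|phi2 phi2E] := @ear_function (fun=> 0) e2; first by move=> i _.
  by rewrite /e2 ltnn andbF.
move: (congr1 phi1 eqV) (congr1 phi2 eqV).
rewrite !phi1E ?phi2E //; try lia.
rewrite /e1 /e2 p0; case: ifP; lia.
Qed.

(** The filter [P] selects the edges kept, so the graph and its subgraphs share one definition. Core
    edges are ears of length one. *)
Definition ear_graph (P : nat -> nat -> bool) : rel 'I_n := fun u v =>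
  [exists c : 'I_m, exists p : 'I_(bs c), P c p &&
     ((u == V c p) && (v == V c p.+1) || (v == V c p) && (u == V c p.+1))].

Local Notation G := (ear_graph (fun _ _ => true)).

Lemma ear_graphI (P : nat -> nat -> bool) c p :
  c < m -> p < bs c -> P c p -> ear_graph P (V c p) (V c p.+1).
Proof.
move=> lt_c lt_p Pcp; apply/existsP; exists (Ordinal lt_c).
by apply/existsP; exists (Ordinal lt_p); rewrite /= Pcp !eqxx.
Qed.

Lemma ear_graphP (P : nat -> nat -> bool) u v : ear_graph P u v ->
  exists c p, [/\ c < m, p < bs c, P c p &
    u = V c p /\ v = V c p.+1 \/ v = V c p /\ u = V c p.+1].
Proof.
case/existsP=> c /existsP[p /andP[Pcp uv]]; exists c, p.
split=> //; case/orP: uv => /andP[/eqP -> /eqP ->]; by [left|right].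
Qed.

Lemma ear_graph_sym P : symmetric (ear_graph P).
Proof.
move=> u v; apply/existsP/existsP=> -[c /existsP[p uv]]; exists c;
  by apply/existsP; exists p; rewrite orbC.
Qed.

Lemma ear_step_neq c p : c < m -> p < bs c -> V c p != V c p.+1.
Proof.
move=> lt_c lt_p; apply/eqP=> eqV.
case p0: (0 < p).
  have p_int : 0 < p < bs c by lia.
  by case: (ear_vertex_inj lt_c lt_c p_int lt_p eqV); lia.
case pb: (p.+1 < bs c).
  have p_int : 0 < p.+1 < bs c by lia.
  by case: (ear_vertex_inj lt_c lt_c p_int (ltnW lt_p) (esym eqV)); lia.
move: (congr1 val eqV) (xs_ys lt_c); rewrite /= !val_ear_vertex //; last lia.
rewrite /vtx; have -> : p == 0 by lia.
have -> : p.+1 == bs c by lia.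
by move=> /= ->; rewrite eqxx.
Qed.

Lemma ear_graph_simple P : simple_graph (ear_graph P).
Proof.
split; first exact: ear_graph_sym.
move=> u; case Guu: (ear_graph P u u) => //.
have [c [p [lt_c lt_p _ uu]]] := ear_graphP Guu.
move: (ear_step_neq lt_c lt_p).
by case: uu => -[<- <-]; rewrite eqxx.
Qed.

(** * Potentials on a spanner *)

Section Spanner.

Variable H : rel 'I_n.
Hypothesis spanH : spanner k G H.

Let symH : symmetric H. Proof. by case: spanH => -[[]]. Qed.
Let subH : subrel H G. Proof. by case: spanH => -[]. Qed.

(** [H] bridges each edge of [G] by at most [k] edges, so steps of size at most one on [H] become
    steps of size at most [k] on [G]. *)
Lemma spanner_lipschitz (f : nat -> nat) (e : nat -> nat -> nat) c q :
  (forall c, c < m -> e c 0 = f (xs c)) ->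
  (forall c, c < m -> e c (bs c) = f (ys c)) ->
  (forall c p, c < m -> p < bs c -> H (V c p) (V c p.+1) ->
     e c p <= e c p.+1 + 1 /\ e c p.+1 <= e c p + 1) ->
  c < m -> q < bs c -> e c q.+1 <= e c q + k /\ e c q <= e c q.+1 + k.
Proof.
move=> e0 eb lip lt_c lt_q.
have [phi phiE] := ear_function e0 eb.
have philip x y : H x y -> phi y <= phi x + 1.
  move=> Hxy; have [i [p [lt_i lt_p _]]] := ear_graphP (subH Hxy).
  case=> -[xE yE]; move: Hxy; rewrite xE yE ?[H (V i p.+1) _]symH;
    move=> /(lip _ _ lt_i lt_p) [le1 le2]; rewrite !phiE //; lia.
have [d le_d Hd] := spanner_edge spanH (@ear_graphI _ c q lt_c lt_q isT).
have := walkb_lipschitz philip Hd.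
have := walkb_lipschitz philip (walkb_rev symH Hd).
by rewrite !phiE //; lia.
Qed.

Lemma missing_ear_uniq c q q' : c < m -> q < bs c -> q' < bs c ->
  ~~ H (V c q) (V c q.+1) -> ~~ H (V c q') (V c q'.+1) -> q = q'.
Proof.
wlog: q q' / q < q' => [th|lt_qq' lt_c lt_q lt_q' nH nH'].
  case: (ltngtP q q') => // lt_qq' lt_c lt_q lt_q' nH nH'.
    exact: th.
  by apply: esym; apply: th.
exfalso.
(* The stretch between two gaps would be cut off from the rest of [H], so it can be raised above
   [k]. *)
pose e c' p := if (c' == c) && (q < p <= q') then k.+1 else 0.
have [|i _|i p _ _|//||] := @spanner_lipschitz (fun=> 0) e c q => //.
- by move=> i _; rewrite /e ltn0 andbF.
- by rewrite /e; case: eqP => //= ->; case: ifP => //; lia.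
- rewrite /e; case: eqP => //= ->; move=> Hp.
  have /eqP : p != q by apply: contraTneq Hp => ->.
  have /eqP : p != q' by apply: contraTneq Hp => ->.
  by case: ifP; case: ifP; lia.
- by rewrite /e eqxx /=; case: ifP; case: ifP; lia.
Qed.

(* A Lipschitz potential on the core extends over an unbroken ear by taking
   the smaller of the bounds coming from its two ends; over the broken ear c1
   it may jump, and over the broken ear c0 it moves away from its end values
   as fast as possible, so that the two sides of the gap differ most. *)
Lemma missing_potential (f : nat -> nat) c0 q0 c1 q1 :
  c0 < m -> q0 < bs c0 -> ~~ H (V c0 q0) (V c0 q0.+1) ->
  ~~ H (V c1 q1) (V c1 q1.+1) -> q1 < bs c1 ->
  (forall c, c < m -> c != c0 -> c != c1 ->
     f (xs c) <= f (ys c) + bs c /\ f (ys c) <= f (xs c) + bs c) ->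
  f (ys c0) + bs c0 <= f (xs c0) + k.+1.
Proof.
move=> lt_c0 lt_q0 nH0 nH1 lt_q1 lip.
(* The offset [bs c0] keeps the truncated subtraction of [p] exact. *)
pose e c p :=
  if c == c0 then
    if p <= q0 then bs c0 + f (xs c) - p else bs c0 + f (ys c) + (bs c - p)
  else bs c0 + (if c == c1 then if p <= q1 then f (xs c) else f (ys c)
  else minn (f (xs c) + p) (f (ys c) + (bs c - p))).
have [|c lt_c|c p lt_c lt_p|//|//|] :=
  @spanner_lipschitz (fun j => bs c0 + f j) e c0 q0.
- move=> c lt_c; rewrite /e; case: eqVneq => [_|n0] /=; first lia.
  case: eqVneq => [_|n1] //=; case: (lip c lt_c n0 n1); lia.
- rewrite /e; case: eqVneq => [->|n0] /=; first by case: ifP; lia.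
  case: eqVneq => [->|n1] /=; first by case: ifP; lia.
  case: (lip c lt_c n0 n1); lia.
- rewrite /e; case: eqVneq => [->|n0] /= Hp.
    have /eqP : p != q0 by apply: contraTneq Hp => ->.
    by case: ifP; case: ifP; lia.
  case: eqVneq Hp => [-> Hp|n1 _] /=; last by lia.
  have /eqP : p != q1 by apply: contraTneq Hp => ->.
  by case: ifP; case: ifP; lia.
- by rewrite /e eqxx /=; case: ifP; case: ifP; lia.
Qed.

End Spanner.


Lemma ear_prefix_walk (P : nat -> nat -> bool) c q :
  c < m -> q <= bs c -> (forall p, p < q -> P c p) ->
  walkb (ear_graph P) q (V c 0) (V c q).
Proof.
move=> lt_c; elim: q => [|q IHq] le_q Pc; first by rewrite /= eqxx.
have IH := IHq (ltnW le_q) (fun p lt_p => Pc p (ltnW lt_p)).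
have step : walkb (ear_graph P) 1 (V c q) (V c q.+1).
  by rewrite walkb1 ear_graphI // Pc.
by have := walkb_cat IH step; rewrite addn1.
Qed.

Lemma ear_vertex_start c : V c 0 = inord (xs c).
Proof. by []. Qed.

Lemma ear_vertex_end c : c < m -> V c (bs c) = inord (ys c).
Proof.
by move=> lt_c; rewrite /ear_vertex /vtx eqxx; case: eqP (bs_gt0 lt_c) => // ->.
Qed.

End EarGraph.

Lemma cycle_mkseq (T : eqType) (e : rel T) (f : nat -> T) k :
  (forall i, i < k -> e (f i) (f i.+1)) -> e (f k) (f 0) ->
  cycle e (mkseq f k.+1).
Proof.
move=> ef efk.
suff pathf a j : a + j <= k -> path e (f a) (map f (iota a.+1 j)) /\
    last (f a) (map f (iota a.+1 j)) = f (a + j).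
  by rewrite /mkseq /= rcons_path; have [|-> ->] := pathf 0 k.
elim: j a => [|j IHj] a le_ajk /=; first by rewrite addn0.
by have [|-> ->] := IHj a.+1; [lia | rewrite ef ?addSnnS //; lia].
Qed.

(** * The counterexample graph *)

Section Counterexample.

Variables (n' k d : nat).
Hypothesis d_gt0 : 0 < d.
Hypothesis k_d : 2 * d + 4 <= k <= 2 * d + 5.
Hypothesis n_large : 3 * k + 6 <= n'.

(* The length of the arc of ear 1; it is d + 1 or d + 2. *)
Let s := k - 3 - d.
Let w := k.+1 - d.
Let m := w + w + 4.

(* Ear 0 closes the cycle C, ears 1, 2, 3 are the long ears, ear i + 4 is the
   two-edge side of the triangle on the core edge {i, i + 1}, and ear
   w + i + 4 is that core edge itself. *)
Definition ear_src (c : nat) : nat :=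
  match c with
  | 0 => w | 1 => 2 | 2 => 0 | 3 => 2
  | c.+4 => if c < w then c else c - w
  end.

Definition ear_tgt (c : nat) : nat :=
  match c with
  | 0 => 0 | 1 => 2 + s | 2 => 2 + s | 3 => w
  | c.+4 => (if c < w then c else c - w).+1
  end.

Definition ear_len (c : nat) : nat :=
  match c with
  | 0 => d | 1 => d + 4 | 2 => s + 2 | 3 => s + 2
  | c.+4 => if c < w then 2 else 1
  end.

(** Reduces a property of all ears to arithmetic on six kinds of ears. *)
Lemma ear_all (Q : nat -> nat -> nat -> nat -> Prop) :
  Q 0 w 0 d -> Q 1 2 (2 + s) (d + 4) -> Q 2 0 (2 + s) (s + 2) ->
  Q 3 2 w (s + 2) ->
  (forall i, i < w -> Q i.+4 i i.+1 2) ->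
  (forall i, i < w -> Q (w + i).+4 i i.+1 1) ->
  forall c, c < m -> Q c (ear_src c) (ear_tgt c) (ear_len c).
Proof.
move=> Q0 Q1 Q2 Q3 Qt Qc [|[|[|[|c]]]] // lt_c /=.
case: ltnP => [lt_cw|le_wc]; first exact: Qt.
rewrite -{1}(subnKC le_wc); apply: Qc; rewrite /m in lt_c; lia.
Qed.

Lemma ear_src_le c : c < m -> ear_src c <= w.
Proof. by apply: (ear_all (Q := fun c x y b => x <= w)); rewrite /w /s; lia. Qed.

Lemma ear_tgt_le c : c < m -> ear_tgt c <= w.
Proof. by apply: (ear_all (Q := fun c x y b => y <= w)); rewrite /w /s; lia. Qed.

Lemma ear_src_tgt c : c < m -> ear_src c != ear_tgt c.
Proof. by apply: (ear_all (Q := fun c x y b => x != y)); rewrite /w /s; lia. Qed.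

Lemma ear_len_gt0 c : c < m -> 0 < ear_len c.
Proof. by apply: (ear_all (Q := fun c x y b => 0 < b)); rewrite /w /s; lia. Qed.

Lemma ear_total_le :
  w.+1 + sumn (mkseq (fun c => (ear_len c).-1) m) <= n'.+1.
Proof.
have -> : m = 4 + (w + w) by rewrite /m; lia.
rewrite /mkseq !iotaD !map_cat !sumn_cat.
have -> : [seq (ear_len i).-1 | i <- iota (0 + 4) w] = nseq w 1.
  apply: (@eq_from_nth _ 0); rewrite size_map size_iota ?size_nseq // => i lt_i.
  by rewrite (nth_map 0) ?size_iota // nth_iota // nth_nseq lt_i /= lt_i.
have -> : [seq (ear_len i).-1 | i <- iota (0 + 4 + w) w] = nseq w 0.
  apply: (@eq_from_nth _ 0); rewrite size_map size_iota ?size_nseq // => i lt_i.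
  rewrite (nth_map 0) ?size_iota // nth_iota // nth_nseq lt_i /=.
  by rewrite ltnNge leq_addr.
(* The total is [4 * k + 1 - 2 * d], at most [3 * k + 6] since [k <= 2 * d + 5]. *)
by rewrite !sumn_nseq /= /s /w; lia.
Qed.

Local Notation V := (ear_vertex n' w m ear_src ear_tgt ear_len).
Local Notation graph := (@ear_graph n' w m ear_src ear_tgt ear_len).
Local Notation G := (graph (fun _ _ => true)).

Lemma core_ear_vertices i :
  V (w + i).+4 0 = inord i /\ V (w + i).+4 1 = inord i.+1.
Proof.
have lt_wi : (w + i < w) = false by lia.
by rewrite /ear_vertex /vtx /= lt_wi addKn.
Qed.

(** Ear 0 comes first, so its interior continues the core numbering and C visits 0, ..., k in
    order. *)
Lemma ear0_vertex q : q < d -> V 0 q = inord (w + q).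
Proof.
move=> lt_q; rewrite /ear_vertex /vtx /=; case: eqP => [->|q_n0].
  by rewrite addn0.
have -> : q == d = false by lia.
by rewrite /flatten_index take0 /=; congr inord; lia.
Qed.

(** * Pairs of edges that a spanner cannot both miss *)

Section Spanner.

Variable H : rel 'I_n'.+1.
Hypothesis spanH : spanner k G H.
Local Notation intact c q := (H (V c q) (V c q.+1)).

Local Notation lipschitz_off f c0 c1 := (fun c x y b =>
  c != c0 -> c != c1 -> f x <= f y + b /\ f y <= f x + b).

Let potential f c0 q0 c1 q1 :
  c0 < m -> q0 < ear_len c0 -> q1 < ear_len c1 ->
  ~~ intact c0 q0 -> ~~ intact c1 q1 ->
  (forall c, c < m ->
     lipschitz_off f c0 c1 c (ear_src c) (ear_tgt c) (ear_len c)) ->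
  f (ear_tgt c0) + ear_len c0 <= f (ear_src c0) + k.+1.
Proof.
move=> lt_c0 lt_q0 lt_q1 nH0 nH1.
apply: (missing_potential _ _ _ spanH) nH0 nH1 _ => //.
- exact: ear_src_le.
- exact: ear_tgt_le.
- exact: ear_total_le.
Qed.

(* In the next lemmas f is (a truncation of) the distance in G, without the two
   broken ears, from one end of the first of them. *)
Lemma triangle_missing i q : i < w -> q < 2 ->
  ~~ intact i.+4 q -> ~~ intact (w + i).+4 0 -> False.
Proof.
move=> lt_i lt_q nH nH'.
pose f j := if j <= i then i - j else k.+1 + i - j.
have lt_m : i.+4 < m by rewrite /m; lia.
have lt_q4 : q < ear_len i.+4 by rewrite /= lt_i.
have lt_04 : 0 < ear_len (w + i).+4 by rewrite /=; case: ifP.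
have lip : forall c, c < m ->
    lipschitz_off f i.+4 (w + i).+4 c (ear_src c) (ear_tgt c) (ear_len c).
  apply: (ear_all (Q := lipschitz_off f i.+4 (w + i).+4));
    rewrite /f /w /s /= in lt_i *; intros; do ?[case: ifP => ?]; lia.
move: (potential lt_m lt_q4 lt_04 nH nH' lip).
by rewrite /= lt_i /f leqnn ltnn; move: lt_i; rewrite /w; lia.
Qed.

(** With an arc edge gone, the ends of ear 1 are [s + 1] apart, through a triangle; the other
    [d + 3] edges of the ear bring the detour to [k + 1]. *)
Lemma ear1_missing i q : 2 <= i < 2 + s -> q < d + 4 ->
  ~~ intact 1 q -> ~~ intact (w + i).+4 0 -> False.
Proof.
move=> lt_i lt_q nH nH'.
pose f j := if j <= 2 then 2 - j else if j <= i then j - 2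
  else if j <= 2 + s then j - 1 else s + 1 - (j - 2 - s).
have lt_m : 1 < m by rewrite /m; lia.
have lt_04 : 0 < ear_len (w + i).+4 by rewrite /=; case: ifP.
have lip : forall c, c < m ->
    lipschitz_off f 1 (w + i).+4 c (ear_src c) (ear_tgt c) (ear_len c).
  apply: (ear_all (Q := lipschitz_off f 1 (w + i).+4));
    rewrite /f /w /s /= in lt_i *; intros; do ?[case: ifP => ?]; lia.
move: (potential (q0 := q) lt_m lt_q lt_04 nH nH' lip).
by rewrite /= /f ?leqnn; rewrite /s in lt_i *; do ?[case: ifP => ?]; lia.
Qed.

Lemma ear2_core_missing i q : 2 + s <= i < w -> q < s + 2 ->
  ~~ intact 2 q -> ~~ intact (w + i).+4 0 -> False.
Proof.
move=> lt_i lt_q nH nH'.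
pose f j := if j <= 2 + s then minn j (d + 3)
  else if j <= i then d + 1 + w - j else d + w - j.
have lt_m : 2 < m by rewrite /m; lia.
have lt_04 : 0 < ear_len (w + i).+4 by rewrite /=; case: ifP.
have lip : forall c, c < m ->
    lipschitz_off f 2 (w + i).+4 c (ear_src c) (ear_tgt c) (ear_len c).
  apply: (ear_all (Q := lipschitz_off f 2 (w + i).+4));
    rewrite /f /w /s /= in lt_i *; intros; do ?[case: ifP => ?]; lia.
move: (potential (q0 := q) lt_m lt_q lt_04 nH nH' lip).
by rewrite /= /f ?leqnn; rewrite /s in lt_i *; do ?[case: ifP => ?]; lia.
Qed.

(** Without ear 0, the core route between the ends of ear 2 has length [s + 2 >= d + 3], one more
    than the arc: too long by one. *)
Lemma ear2_ear0_missing q q' : q < s + 2 -> q' < d ->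
  ~~ intact 2 q -> ~~ intact 0 q' -> False.
Proof.
move=> lt_q lt_q' nH nH'.
pose f j := minn j (d + 3).
have lt_m : 2 < m by rewrite /m; lia.
have lip : forall c, c < m ->
    lipschitz_off f 2 0 c (ear_src c) (ear_tgt c) (ear_len c).
  apply: (ear_all (Q := lipschitz_off f 2 0)); rewrite /f /w /s /=; lia.
move: (potential (q0 := q) (c1 := 0) lt_m lt_q lt_q' nH nH' lip).
by rewrite /= /f /s; lia.
Qed.

(** The reflection [j] to [w - j] exchanges ears 2 and 3. Ear 3 is directed towards [w], so the
    reflected potential is subtracted from [d + 3]. *)
Lemma ear3_core_missing i q : i < 2 -> q < s + 2 ->
  ~~ intact 3 q -> ~~ intact (w + i).+4 0 -> False.
Proof.
move=> lt_i lt_q nH nH'.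
pose f j := if 2 <= j then d + 3 - minn (w - j) (d + 3)
  else if i < j then 2 - j else 3 - j.
have lt_m : 3 < m by rewrite /m; lia.
have lt_04 : 0 < ear_len (w + i).+4 by rewrite /=; case: ifP.
have lip : forall c, c < m ->
    lipschitz_off f 3 (w + i).+4 c (ear_src c) (ear_tgt c) (ear_len c).
  apply: (ear_all (Q := lipschitz_off f 3 (w + i).+4));
    rewrite /f /w /s /= in lt_i *; intros; do ?[case: ifP => ?]; lia.
move: (potential (q0 := q) lt_m lt_q lt_04 nH nH' lip).
by rewrite /= /f ?leqnn; rewrite /w /s in lt_i *; do ?[case: ifP => ?]; lia.
Qed.

Lemma ear3_ear0_missing q q' : q < s + 2 -> q' < d ->
  ~~ intact 3 q -> ~~ intact 0 q' -> False.
Proof.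
move=> lt_q lt_q' nH nH'.
pose f j := d + 3 - minn (w - j) (d + 3).
have lt_m : 3 < m by rewrite /m; lia.
have lip : forall c, c < m ->
    lipschitz_off f 3 0 c (ear_src c) (ear_tgt c) (ear_len c).
  apply: (ear_all (Q := lipschitz_off f 3 0)); rewrite /f /w /s /=; lia.
move: (potential (q0 := q) (c1 := 0) lt_m lt_q lt_q' nH nH' lip).
by rewrite /= /f /w /s; lia.
Qed.

(** * Counting the missing edges of a spanner of large girth *)

Lemma cycle_missing : girth_at_least H (k + 2) ->
  (exists2 i, i < w & ~~ intact (w + i).+4 0) \/
  (exists2 q, q < d & ~~ intact 0 q).
Proof.
move=> girthH.
case core_intact: [forall i : 'I_w, intact (w + i).+4 0]; last first.
  move/forallPn: core_intact => [i nHi]; left; by exists i.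
case D_intact: [forall q : 'I_d, intact 0 q]; last first.
  move/forallPn: D_intact => [q nHq]; right; by exists q.
exfalso; move: girthH; rewrite addn2; apply: girth_short_cycle; first by lia.
apply/existsP; exists (mktuple (fun i : 'I_k.+1 => inord i)); apply/andP; split.
  rewrite map_inj_uniq ?enum_uniq // => i j /(congr1 val) /=.
  rewrite !inordK; try (move: (ltn_ord i) (ltn_ord j); lia).
  exact: val_inj.
have -> : val (mktuple (fun i : 'I_k.+1 => inord i : 'I_n'.+1)) =
    mkseq (fun i => inord i) k.+1.
  by rewrite /mkseq -val_enum_ord -map_comp.
have w_d : w + d = k.+1 by rewrite /w; lia.
move/forallP: core_intact => core_intact; move/forallP: D_intact => D_intact.
apply: cycle_mkseq => [i lt_i|].
  have [lt_iw|le_wi] := ltnP i w.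
    by move: (core_intact (Ordinal lt_iw)); have [-> ->] := core_ear_vertices i.
  have lt_id : (i - w).+1 < d by lia.
  move: (D_intact (Ordinal (ltnW lt_id))); rewrite /= !ear0_vertex //; last lia.
  by rewrite addnS subnKC.
have lt_d : d.-1 < d by lia.
move: (D_intact (Ordinal lt_d)); rewrite /= ear0_vertex // prednK //.
have -> : V 0 d = inord 0 by rewrite /ear_vertex /vtx eqxx; case: eqP d_gt0 => // ->.
by congr (H (inord _) _); lia.
Qed.

(* Missing edges receive distinct labels: a triangle misses at most one of its
   three edges, and so does the union of ears 0 and 2. *)
Definition ear_label (c : nat) : nat :=
  match c with 0 => 2 | c'.+4 => if c' < w then c else c - w | _ => c end.

Lemma ear_label_inj c q c' q' : c < m -> q < ear_len c -> ~~ intact c q ->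
  c' < m -> q' < ear_len c' -> ~~ intact c' q' ->
  ear_label c = ear_label c' -> c = c' /\ q = q'.
Proof.
move=> lt_c lt_q nH lt_c' lt_q' nH' eq_l.
suff eq_c : c = c'.
  split=> //; rewrite -eq_c in lt_q' nH'.
  apply: (missing_ear_uniq _ _ _ spanH) nH nH' => //.
  - exact: ear_src_le.
  - exact: ear_tgt_le.
  - exact: ear_total_le.
wlog: c q c' q' lt_c lt_q nH lt_c' lt_q' nH' eq_l / c < c' => [th|].
  case: (ltngtP c c') => // lt_cc'; first exact: (th c q c' q').
  by apply: esym; apply: (th c' q' c q).
move=> lt_cc'; exfalso.
have core_ext j : w <= j -> j.+4 < m ->
    exists2 i, i < w & j = w + i.
  by move=> le_wj; rewrite /m => lt_j; exists (j - w); lia.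
case: c lt_c lt_q nH eq_l lt_cc' => [|[|[|[|c]]]];
case: c' lt_c' lt_q' nH' => [|[|[|[|c']]]] //=; try by (case: ifP; lia).
- by move=> _ lt_q' nH' _ lt_q nH _ _; apply: (ear2_ear0_missing lt_q' lt_q).
move=> lt_c' lt_q' nH' lt_c lt_q nH.
case: ifP lt_q => [lt_cw lt_q|]; case: ifP lt_q' => [|le_wc' lt_q']; try lia.
have [||i lt_i c'E] := core_ext c'; [by lia | by [] | ].
move=> eq_l _; move: nH'; rewrite c'E (_ : q' = 0); last lia.
by apply: (triangle_missing lt_i lt_q); rewrite (_ : i = c) //; lia.
Qed.

(** The omitted label is that of a long ear whose arc is broken. A broken ear 0 is treated first: it
    gives label 3, and afterwards label 2 can only come from ear 2. *)
Lemma ear_label_omitted : girth_at_least H (k + 2) ->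
  exists2 l, 0 < l < w + 4 & forall c q, c < m -> q < ear_len c ->
    ~~ intact c q -> ear_label c <> l.
Proof.
move=> girthH.
have label1 c : c < m -> ear_label c = 1 -> c = 1.
  by case: c => [|[|[|[|c]]]] //=; case: ifP; lia.
have label2 c : c < m -> ear_label c = 2 -> c = 0 \/ c = 2.
  by case: c => [|[|[|[|c]]]] //=; [left|right|case: ifP; lia].
have label3 c : c < m -> ear_label c = 3 -> c = 3.
  by case: c => [|[|[|[|c]]]] //=; case: ifP; lia.
case D_missing: [exists q : 'I_d, ~~ intact 0 q].
  case/existsP: D_missing => q' nHq'.
  exists 3 => [|c q lt_c lt_q nH /label3 cE]; first by lia.
  rewrite {}cE // in lt_q nH.
  exact: (ear3_ear0_missing lt_q (ltn_ord q') nH nHq').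
case: (cycle_missing girthH) => [[i lt_i nHi]|[q lt_q nHq]]; last first.
  by case/existsP: D_missing; exists (Ordinal lt_q).
have [lt_i2|le_2i] := ltnP i 2.
  exists 3 => [|c q lt_c lt_q nH /label3 cE]; first by lia.
  by rewrite {}cE // in lt_q nH; apply: (ear3_core_missing lt_i2 lt_q nH nHi).
have [lt_is|le_si] := ltnP i (2 + s).
  exists 1 => [|c q lt_c lt_q nH /label1 cE]; first by lia.
  rewrite {}cE // in lt_q nH; apply: (ear1_missing _ lt_q nH nHi).
  by rewrite le_2i.
exists 2 => [|c q lt_c lt_q nH /label2 []// cE]; first by lia.
  rewrite {}cE in lt_q nH; case/existsP: D_missing.
  by exists (Ordinal lt_q).
rewrite {}cE in lt_q nH; apply: (ear2_core_missing _ lt_q nH nHi).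
by rewrite le_si.
Qed.

Lemma ear_label_bound c : c < m -> 0 < ear_label c < w + 4.
Proof. by rewrite /m; case: c => [|[|[|[|c]]]] /=; try case: ifP; lia. Qed.

(** Labels are distinct, lie between 1 and [w + 3], and avoid one value. *)
Lemma card_missing_le : girth_at_least H (k + 2) -> #|missing G H| <= w + 2.
Proof.
move=> /ear_label_omitted[l /andP[l_gt0 lt_l] l_omit].
have symH : symmetric H by case: spanH => -[[]].
have /fin_all_exists[lab labP] (p : 'I_n'.+1 * 'I_n'.+1) :
    exists l : 'I_(w + 4), p \in missing G H -> exists c q,
      [/\ c < m, q < ear_len c, ~~ intact c q, l = ear_label c :> nat &
        p.1 = V c q /\ p.2 = V c q.+1 \/ p.2 = V c q /\ p.1 = V c q.+1].
  (* Pairs that are not missing edges get a dummy label. *)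
  case Mp: (p \in missing G H); last by exists (Ordinal lt_l).
  move: Mp; rewrite inE => /and3P[_ /ear_graphP[c [q [lt_c lt_q _ pE]]] nHp].
  have /andP[_ lt_lc] := ear_label_bound lt_c.
  exists (Ordinal lt_lc) => _; exists c, q; split=> //.
  by case: pE nHp => -[-> ->] //; rewrite symH.
have lab_inj : {in missing G H &, injective lab}.
  move=> p p' Mp Mp' eq_lab.
  have [c [q [lt_c lt_q nH labp pE]]] := labP p Mp.
  have [c' [q' [lt_c' lt_q' nH' labp' pE']]] := labP p' Mp'.
  have [] := ear_label_inj lt_c lt_q nH lt_c' lt_q' nH'.
    by rewrite -labp -labp' eq_lab.
  move=> eq_c eq_q; rewrite -{}eq_c -{}eq_q in pE'.
  (* The order of the endpoints excludes opposite readings of one edge. *)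
  move: Mp Mp'; rewrite !inE => /and3P[lt_p _ _] /and3P[lt_p' _ _].
  rewrite [p]surjective_pairing [p']surjective_pairing.
  case: pE pE' => -[p1 p2] [] [p1' p2'];
    by move: lt_p lt_p'; rewrite ?p1 ?p2 ?p1' ?p2' //; lia.
rewrite -(card_in_imset lab_inj).
have w4_gt0 : 0 < w + 4 by lia.
have: lab @: missing G H \subset ~: [set Ordinal w4_gt0; Ordinal lt_l].
  apply/subsetP=> _ /imsetP[p Mp ->]; rewrite !inE -!val_eqE /=.
  have [c [q [lt_c lt_q nH -> _]]] := labP p Mp.
  have /andP[l0 _] := ear_label_bound lt_c.
  by have := l_omit c q lt_c lt_q nH; lia.
move/subset_leq_card/leq_trans; apply.
have := cardsC [set Ordinal w4_gt0; Ordinal lt_l].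
rewrite cards2 card_ord -val_eqE /=; lia.
Qed.

End Spanner.

(** * A sparser spanner containing C *)

(** Long ears and triangle sides lose their last edge; ear 0 and the core edges, which make up C,
    stay whole. *)
Let kept c q := ~~ ((0 < c < w + 4) && (q.+1 == ear_len c)).
Local Notation thin := (graph kept).

Let V_inj c p c' p' : c < m -> c' < m -> 0 < p < ear_len c ->
  p' <= ear_len c' -> V c p = V c' p' -> c = c' /\ p = p'.
Proof.
apply: ear_vertex_inj; [exact: ear_src_le|exact: ear_tgt_le|exact: ear_total_le].
Qed.

Lemma ear_len_gt1 c : 0 < c < w + 4 -> 1 < ear_len c.
Proof.
rewrite /s; case: c => [|[|[|[|c]]]] //=; try lia.
by move=> lt_c; have -> : c < w by lia.
Qed.

Let V_end c : c < m -> V c (ear_len c) <= w.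
Proof.
move=> lt_c; rewrite (val_ear_vertex ear_src_le ear_tgt_le ear_total_le) //.
rewrite /vtx eqxx; case: eqP => _; [exact: ear_src_le | exact: ear_tgt_le].
Qed.

Lemma card_missing_thin : w + 3 <= #|missing G thin|.
Proof.
(* The core end comes first, being the smaller number. *)
pose drop (i : 'I_(w + 3)) :=
  (V i.+1 (ear_len i.+1), V i.+1 (ear_len i.+1).-1).
have c_lt (i : 'I_(w + 3)) : 0 < i.+1 < w + 4 by have := ltn_ord i; lia.
have c_m (i : 'I_(w + 3)) : i.+1 < m.
  by have := ltn_ord i; rewrite /m /w; lia.
have drop_int (i : 'I_(w + 3)) : 0 < (ear_len i.+1).-1 < ear_len i.+1.
  by have := ear_len_gt1 (c_lt i); lia.
have drop_inj : injective drop.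
  move=> i j [_ eqV]; have /andP[_ /ltnW le_j] := drop_int j.
  case: (V_inj (c_m i) (c_m j) (drop_int i) le_j eqV) => -[eq_ij] _.
  exact: val_inj.
rewrite -[w + 3]card_ord -cardsT -(card_imset _ drop_inj).
apply: subset_leq_card; apply/subsetP=> _ /imsetP[i _ ->]; rewrite inE /drop.
have lt_c := c_m i; move: (i.+1) lt_c (c_lt i) (drop_int i) => c lt_c c_lt' c_int /=.
apply/and3P; split.
- apply: (leq_ltn_trans (V_end lt_c)).
  rewrite (val_ear_vertex ear_src_le ear_tgt_le ear_total_le) //; last lia.
  by have /andP[] := vtx_interior ear_src ear_tgt ear_total_le lt_c c_int.
- rewrite ear_graph_sym -{2}(prednK (n := ear_len c)); last lia.
  by apply: ear_graphI => //; lia.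
(* The interior end fixes the ear; one direction contradicts the position of the core end, the other
   gives the dropped edge itself. *)
apply/negP=> /ear_graphP[c' [p' [lt_c' lt_p' keep]]].
case=> -[eq1 eq2].
  have [|eq_c eq_p] := V_inj lt_c lt_c' c_int _ eq2; first lia.
  rewrite -{}eq_c in lt_p' eq1 keep.
  have [p0|p'_gt0] := posnP p'.
    move: (congr1 val eq1) (ear_src_tgt lt_c); rewrite p0 /=.
    rewrite !(val_ear_vertex ear_src_le ear_tgt_le ear_total_le) //.
    rewrite /vtx eqxx /=; case: eqP => [len0|_ ->]; last by rewrite eqxx.
    by move: (ear_len_gt0 lt_c); rewrite len0.
  have p'_int : 0 < p' < ear_len c by lia.
  by have [|_] := V_inj lt_c lt_c p'_int _ (esym eq1); lia.
have [eq_c eq_p] := V_inj lt_c lt_c' c_int (ltnW lt_p') eq1.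
by move: keep; rewrite /kept -eq_c -eq_p c_lt' /=; lia.
Qed.

Lemma thin_core_walk i j : i <= j <= w ->
  walkb thin (j - i) (inord i) (inord j).
Proof.
elim: j => [|j IHj] le_ij; first by case: i le_ij => //= _; rewrite eqxx.
have [->|ne_ij] := eqVneq i j.+1; first by rewrite subnn /= eqxx.
have [eq0 eq1] := core_ear_vertices j.
have lt_c : (w + j).+4 < m by rewrite /m; lia.
have step : walkb thin 1 (inord j) (inord j.+1).
  rewrite walkb1 -eq0 -eq1; apply: ear_graphI => //; first exact: ear_len_gt0.
  by rewrite /kept; lia.
have -> : j.+1 - i = (j - i) + 1 by lia.
by apply: walkb_cat step; apply: IHj; lia.
Qed.

Lemma thin_ear0_walk : walkb thin d (inord w) (inord 0).
Proof.
have lt_m : 0 < m by rewrite /m; lia.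
have := ear_vertex_end n' w ear_src ear_tgt ear_len_gt0 lt_m.
rewrite /= => <-; rewrite -[inord w]/(V 0 0).
exact: (@ear_prefix_walk n' w m ear_src ear_tgt ear_len kept 0 d).
Qed.

(** A dropped edge is bypassed by going back along its ear and then along the arc, [k] edges in all
    for a long ear and two for a triangle. *)
Lemma thin_spanner : spanner k G thin.
Proof.
have thin_sym : symmetric thin by apply: ear_graph_sym.
apply: spannerI.
  split; first exact: (ear_graph_simple ear_src_le ear_tgt_le ear_src_tgt
    ear_total_le).
  by move=> u v /ear_graphP[c [q [lt_c lt_q _ [] [-> ->]]]];
    rewrite ?[graph _ (V c q.+1) _]ear_graph_sym; apply: ear_graphI.
move=> u v /ear_graphP[c [q [lt_c lt_q _ uv]]].
suff [e le_e We] : exists2 e, e <= k & walkb thin e (V c q) (V c q.+1).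
  by exists e => //; case: uv => -[-> ->] //; apply: walkb_rev.
case keep: (kept c q).
  by exists 1; [lia | rewrite walkb1; apply: ear_graphI].
move/negbT: keep; rewrite negbK => /andP[c_lt /eqP q_len].
have back : walkb thin q (V c q) (V c 0).
  apply: walkb_rev => //; apply: ear_prefix_walk => // [|p lt_p].
    exact: ltnW.
  by rewrite /kept; lia.
suff [e le_e We] : exists2 e, q + e <= k &
    walkb thin e (inord (ear_src c)) (inord (ear_tgt c)).
  exists (q + e) => //; apply: walkb_cat back _.
  by rewrite q_len (ear_vertex_end _ _ _ _ ear_len_gt0).
have coreW := thin_core_walk; have DW := walkb_rev thin_sym thin_ear0_walk.
case: c lt_c c_lt q_len {lt_q uv back} => [|[|[|[|c]]]] //= lt_c c_lt q_len.
- exists s; first by rewrite /s; lia.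
  by have := coreW 2 (2 + s); rewrite addKn; apply; rewrite /w /s; lia.
- exists (d + 2); first by rewrite /s in q_len; lia.
  apply: walkb_cat DW _; apply: walkb_rev => //.
  have w_s : w - (2 + s) = 2 by rewrite /w /s; lia.
  by have := coreW (2 + s) w; rewrite w_s; apply; rewrite /w /s; lia.
- exists (2 + d); first by rewrite /s in q_len; lia.
  apply: walkb_cat DW; apply: walkb_rev => //.
  by apply: (coreW 0 2); rewrite /w; lia.
have lt_cw : c < w by lia.
rewrite lt_cw in q_len *; exists 1; first by lia.
by have := coreW c c.+1; rewrite subSnn; apply; lia.
Qed.

Lemma not_good_ear_graph : ~ good n'.+1 k.
Proof.
move=> good_nk; have [|H [[spanH minH] girthH]] := good_nk G.
  exact: (ear_graph_simple ear_src_le ear_tgt_le ear_src_tgt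
    ear_total_le).
have subH : subrel H G by case: spanH => -[].
have subT : subrel thin G by case: thin_spanner => -[].
have := minH _ thin_spanner; have := card_missing_le spanH girthH.
have := nedges_missing subH; have := nedges_missing subT.
have := card_missing_thin; lia.
Qed.

End Counterexample.

(** * Choice of the constants *)

Local Open Scope ring_scope.

Theorem theorem1p6 :
  exists (c1 c2 : rat) (N : nat), 0 < c1 /\ 0 < c2 /\
    forall n k : nat, (N <= n)%N ->
      c1 < k%:R -> k%:R < n%:R / 3 - c2 ->
      ~ good n k.
Proof.
exists 6, 3, 0%N; do 2!split=> //; move=> n k _ k_gt n_gt.
have {}k_gt : (6 < k)%N by rewrite -(ltr_nat rat).
have {n_gt} : (3 * k + 9 < n)%N.
  by rewrite -(ltr_nat rat) natrD natrM; lra.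
(* This [d] satisfies [2 * d + 4 <= k <= 2 * d + 5] and is positive because [k > 6]. *)
case: n => // n n_gt; apply: (@not_good_ear_graph n k (k./2 - 2)); lia.
Qed.
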